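(* Let $f, g:[0,1]\to[0,\infty)$ be two continuous and comonotone functions, let $s>1$ be a real number, and let $\mu$ be the Lebesgue measure on $\mathbb{R}$. Then $$\left((S)\!\int_0^1 f^s\,d\mu\right)\cdot\left((S)\!\int_0^1 g^s\,d\mu\right)\le (S)\!\int_0^1 (f\cdot g)^s\,d\mu,$$ where $(S)\!\int_0^1$ denotes the Sugeno integral over $[0,1]$.
   Context: For a measurable function $u:[0,1]\to[0,\infty)$, the Sugeno integral of $u$ on $[0,1]$ with respect to $\mu$ is $$(S)\!\int_0^1 u\,d\mu=\sup_{\alpha\ge 0}\min\bigl(\alpha,\ \mu(\{x\in[0,1]: u(x)\ge\alpha\})\bigr).$$ Two functions $f,g:[0,1]\to\mathbb{R}$ are comonotone if $(f(x)-f(y))(g(x)-g(y))\ge 0$ for all $x,y\in[0,1]$. Powers and products of functions are taken pointwise. *)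

(* Defs.v *)
From HB Require Import structures.
From mathcomp Require Import all_boot all_order all_algebra.
From mathcomp Require Import all_classical all_reals all_analysis.

Set Implicit Arguments.
Unset Strict Implicit.
Unset Printing Implicit Defensive.

Import Order.TTheory GRing.Theory Num.Theory.
Import numFieldNormedType.Exports.

Local Open Scope classical_set_scope.
Local Open Scope ring_scope.

(* Functions on [0, 1] are represented by functions on R, of which only the
   values on [0, 1] matter. *)

(* The supremum is taken in the extended reals, where [mu] takes its values. *)
Definition sugeno_integral (R : realType)
    (mu : {measure set (measurableTypeR R) -> \bar R}) (u : R -> R) : \bar R :=
  ereal_sup [set mine a%:E (mu [set x : R | x \in `[0, 1] /\ a <= u x])
            | a in [set a : R | 0 <= a]].

Definition comonotone01 (R : realType) (f g : R -> R) : Prop :=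
  forall x y : R, x \in `[0, 1] -> y \in `[0, 1] ->
    0 <= (f x - f y) * (g x - g y).

(* Main.v *)
Require Import Defs.
From HB Require Import structures.
From mathcomp Require Import all_boot all_order all_algebra.
From mathcomp Require Import all_classical all_reals all_analysis.
From mathcomp Require Import measurable_realfun.

Set Implicit Arguments.
Unset Strict Implicit.
Unset Printing Implicit Defensive.

Import Order.TTheory GRing.Theory Num.Theory.
Import numFieldNormedType.Exports.

Local Open Scope classical_set_scope.
Local Open Scope ring_scope.

(** Put [u = f^s] and [v = g^s], with superlevel sets [U_a] and [V_b] in [0,1]. Since [0,1] has
    measure 1, it suffices by [ereal_sup_mul_le] to bound each product
    [min(a, mu U_a) * min(b, mu V_b)]. It is at most [a * b], and also at most [mu U_a * mu V_b],
    hence at most the smaller of these two measures. Comonotonicity makes [U_a] and [V_b] nested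
    ([comonotone01_nested]), so the smaller set lies in both, and there [u * v >= a * b]. The
    product is thus at most the term of threshold [a * b] in the integral of [u * v]. *)

(** Nonemptiness and the bounds 0 and 1 make the factors finite nonnegative reals, and
    multiplication by such a real commutes with the supremum of a nonempty set. *)
Lemma ereal_sup_mul_le (R : realType) (A B : set (\bar R)) (M : \bar R) :
  A !=set0 -> B !=set0 ->
  (forall x, A x -> (0 <= x <= 1)%E) -> (forall y, B y -> (0 <= y <= 1)%E) ->
  (forall x y, A x -> B y -> (x * y <= M)%E) ->
  (ereal_sup A * ereal_sup B <= M)%E.
Proof.
move=> /set0P A0 /set0P B0 A01 B01 AB.
have unit_real (x : \bar R) : (0 <= x <= 1)%E -> exists2 r, 0 <= r & x = r%:E.
  by case: x => [r| |] /andP[] // r0 _; exists r.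
have [|r r0 supA] := unit_real (ereal_sup A).
  move: A0 => /set0P[x Ax]; apply/andP; split.
    by rewrite (le_trans _ (ereal_sup_ubound Ax))//; case/andP: (A01 _ Ax).
  by apply: ge_ereal_sup => y /A01 /andP[].
rewrite supA -ereal_supZl//; apply: ge_ereal_sup => _ [y By <-].
have [q q0 yE] := unit_real _ (B01 _ By).
rewrite -supA yE muleC -ereal_supZl//; apply: ge_ereal_sup => _ [x Ax <-].
by rewrite muleC -yE; exact: AB.
Qed.

Definition superlevel01 (R : realType) (u : R -> R) (a : R) : set R :=
  [set x : R | x \in `[0, 1] /\ a <= u x].

(** A point of the first set outside the second and a point of the second outside the first would be
    ordered oppositely by [u] and [v]. *)
Lemma comonotone01_nested (R : realType) (u v : R -> R) (a b : R) :
  comonotone01 u v ->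
  superlevel01 u a `<=` superlevel01 v b \/
  superlevel01 v b `<=` superlevel01 u a.
Proof.
move=> uv; apply: contrapT => /not_orP[].
move=> /existsNP[x /not_implyP[[x01 ax] nbx]].
move=> /existsNP[y /not_implyP[[y01 byy] nay]].
have uyx : u y < u x.
  by apply: lt_le_trans ax; rewrite ltNge; apply/negP => ?; apply: nay.
have vxy : v x < v y.
  by apply: lt_le_trans byy; rewrite ltNge; apply/negP => ?; apply: nbx.
by have := uv x y x01 y01; rewrite leNgt pmulr_rlt0 ?subr_gt0// subr_lt0 vxy.
Qed.

Lemma comonotone01_powR (R : realType) (f g : R -> R) (s : R) : 0 <= s ->
  (forall x : R, x \in `[0, 1] -> 0 <= f x) ->
  (forall x : R, x \in `[0, 1] -> 0 <= g x) ->
  comonotone01 f g ->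
  comonotone01 (fun x => f x `^ s) (fun x => g x `^ s).
Proof.
move=> s0 f0 g0 fg x y.
wlog fxy : x y / f x <= f y => [hw x01 y01|x01 y01].
  have [/hw|/ltW /hw] := leP (f x) (f y); first exact.
  by move=> /(_ y01 x01); rewrite -mulrNN !opprB.
have powR_le (h : R -> R) z t : (forall w : R, w \in `[0, 1] -> 0 <= h w) ->
    z \in `[0, 1] -> t \in `[0, 1] -> h z <= h t -> h z `^ s <= h t `^ s.
  by move=> h0 z01 t01; apply: ge0_ler_powR; rewrite ?nnegrE ?h0.
have [gxy|gyx] := leP (g x) (g y).
  by apply: mulr_le0; rewrite subr_le0; apply: powR_le.
(* Here [g y < g x], so comonotonicity forces [f x = f y] and the first factor vanishes. *)
have fyx : f y <= f x.
  by have := fg x y x01 y01; rewrite pmulr_lge0 ?subr_gt0// subr_ge0.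
by rewrite (@le_anti _ _ (f x) (f y)) ?fxy// subrr mul0r.
Qed.

Lemma measurable_superlevel01 (R : realType) (u : R -> R) (a : R) :
  measurable_fun (`[0, 1] : set R) u -> measurable (superlevel01 u a).
Proof.
move=> meas_u; have := meas_u (measurable_itv _) _ (measurable_itv `[a, +oo[).
by congr measurable; apply/seteqP; split => x /=; rewrite !in_itv/= ?andbT.
Qed.

(* Comonotone functions have nested superlevel sets [U_a], [V_b], so that
   [mu U_a * mu V_b <= min (mu U_a) (mu V_b) = mu (U_a `&` V_b)]. *)
Lemma sugeno_integral_mul_le (R : realType)
    (mu : {measure set (measurableTypeR R) -> \bar R}) (u v : R -> R) :
  (mu `[0%R, 1%R]%classic <= 1)%E ->
  measurable_fun (`[0, 1] : set R) u -> measurable_fun (`[0, 1] : set R) v ->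
  comonotone01 u v ->
  (sugeno_integral mu u * sugeno_integral mu v
   <= sugeno_integral mu (fun x => u x * v x)%R)%E.
Proof.
move=> mu01 meas_u meas_v uv.
have lvl_le1 (w : R -> R) (a : R) : measurable_fun (`[0, 1] : set R) w ->
    (mu (superlevel01 w a) <= 1)%E.
  move=> mw; apply: le_trans mu01; apply: le_measure; rewrite ?inE//.
  - exact: measurable_superlevel01.
  - by move=> x [].
have min01 (w : R -> R) (a : R) : 0 <= a -> measurable_fun (`[0, 1] : set R) w ->
    (0 <= mine a%:E (mu (superlevel01 w a)) <= 1)%E.
  move=> a0 mw.
  by rewrite le_min lee_fin a0 measure_ge0 ge_min (lvl_le1 _ _ mw) orbT.
apply: ereal_sup_mul_le.
- by eexists; exists 0 => /=.
- by eexists; exists 0 => /=.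
- by move=> _ [a /= a0 <-]; exact: min01.
- by move=> _ [b /= b0 <-]; exact: min01.
move=> _ _ [a /= a0 <-] [b /= b0 <-].
rewrite -/(superlevel01 u a) -/(superlevel01 v b).
set U := superlevel01 u a; set V := superlevel01 v b.
(* To be applied with [W] the smaller of [U] and [V]; nonnegative thresholds allow the bounds
   [a <= u x] and [b <= v x] to be multiplied on [W]. *)
have UVge W : measurable W -> W `<=` U -> W `<=` V ->
    (mu W <= mu (superlevel01 (fun x => u x * v x)%R (a * b)%R))%E.
  move=> mW WU WV; apply: le_measure; rewrite ?inE//.
    by apply: measurable_superlevel01; exact: measurable_funM.
  move=> x Wx; have [x01 ax] := WU _ Wx; have [_ bx] := WV _ Wx.
  by split=> //; apply: ler_pM.
apply: (@le_trans _ _ (mine (a * b)%:E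
    (mu (superlevel01 (fun x => u x * v x)%R (a * b)%R)))); last first.
  by apply: ereal_sup_ubound; exists (a * b) => //=; exact: mulr_ge0.
have /andP[p0 _] := min01 u a a0 meas_u.
have /andP[q0 _] := min01 v b b0 meas_v.
rewrite le_min; apply/andP; split.
  by rewrite EFinM lee_pmul// ge_min lexx.
apply: (@le_trans _ _ (mu U * mu V)%E).
  by rewrite lee_pmul// ge_min lexx orbT.
(* The measure of the larger set is at most 1 and is dropped from the product. *)
have [UV|VU] := comonotone01_nested a b uv.
- apply: (@le_trans _ _ (mu U)); first by rewrite -[leRHS]mule1 lee_pmul ?measure_ge0 ?lvl_le1.
  by apply: UVge => //; exact: measurable_superlevel01.
- apply: (@le_trans _ _ (mu V)).
    by rewrite -[leRHS]mul1e lee_pmul ?measure_ge0 ?lvl_le1.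
  by apply: UVge => //; exact: measurable_superlevel01.
Qed.

Theorem theorem3p2 (R : realType) (f g : R -> R) (s : R)
    (f_ge0 : forall x : R, x \in `[0, 1] -> 0 <= f x)
    (g_ge0 : forall x : R, x \in `[0, 1] -> 0 <= g x)
    (f_cont : {within `[0, 1], continuous f})
    (g_cont : {within `[0, 1], continuous g})
    (fg_comonotone : comonotone01 f g)
    (s_gt1 : 1 < s) :
  (sugeno_integral lebesgue_measure (fun x => (f x `^ s)%R)
     * sugeno_integral lebesgue_measure (fun x => (g x `^ s)%R)
   <= sugeno_integral lebesgue_measure (fun x => ((f x * g x) `^ s)%R))%E.
Proof.
have s0 : 0 <= s by exact: le_trans (ltW s_gt1).
have mpow (h : R -> R) : {within `[0, 1], continuous h} ->
    measurable_fun (`[0, 1] : set R) (fun x => h x `^ s).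
  move=> h_cont; apply: (measurableT_comp (measurable_powR s)).
  exact: subspace_continuous_measurable_fun.
(* Distributing the power over the product uses nonnegativity, known only on [0,1]; the rewriting
   therefore takes place inside the superlevel sets. *)
have -> : sugeno_integral lebesgue_measure (fun x => ((f x * g x) `^ s)%R) =
    sugeno_integral lebesgue_measure (fun x => (f x `^ s * g x `^ s)%R).
  congr ereal_sup; apply: eq_imagel => a _; congr (mine _ (lebesgue_measure _)).
  by apply/seteqP; split => x /= [x01]; rewrite powRM ?f_ge0 ?g_ge0.
apply: sugeno_integral_mul_le; [|exact: mpow|exact: mpow|].
- by have := @lebesgue_measure_itv R `[0, 1]; rewrite /= lte01 sube0 => ->.
- exact: comonotone01_powR.
Qed.
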